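(* Let $f(r)$ denote the minimum number of edges of an $r$-partite intersecting hypergraph $\mathcal{H}$ with $\tau(\mathcal{H}) \ge r-1$. Then $$f(r) \ge \left(3-\frac{1}{\sqrt{18}}\right) r\,(1-o(1)),$$ where $o(1)$ denotes a quantity tending to $0$ as $r \to \infty$.
   Context: A hypergraph is $r$-partite if its vertex set can be partitioned into $r$ parts such that every edge contains precisely one vertex from each part (so edges have size $r$). A hypergraph is intersecting if every two edges have nonempty intersection. The cover number $\tau(\mathcal{H})$ is the minimum size of a vertex set meeting every edge. *)

(* Defs.v *)
From HB Require Import structures.
From mathcomp Require Import all_boot all_order all_algebra.
From mathcomp Require Export reals.

Set Implicit Arguments.
Unset Strict Implicit.
Unset Printing Implicit Defensive.

Definition r_partite (V : finType) (r : nat) (H : {set {set V}}) : Prop :=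
  exists p : V -> 'I_r,
    forall e, e \in H -> forall i : 'I_r, #|[set v in e | p v == i]| = 1%N.

Definition intersecting (V : finType) (H : {set {set V}}) : Prop :=
  forall e f, e \in H -> f \in H -> e :&: f != set0.

Definition is_cover (V : finType) (H : {set {set V}}) (C : {set V}) : bool :=
  [forall e in H, e :&: C != set0].

(* cover number tau(H): minimum size of a cover
   (default #|V| if no cover exists, which only happens when H has an
   empty edge). *)
Definition cover_number (V : finType) (H : {set {set V}}) : nat :=
  \big[minn/#|V|]_(C : {set V} | is_cover H C) #|C|.

(* Main.v *)
(* Cover [H] greedily: pick vertices of residual degree at least 4 as long as
   possible ([t4] of them, leaving [k3] edges), then of degree 3 ([t3],
   leaving [k2] edges), then of degree 2, then 1.  Since the edges pairwise
   meet, [k (k - 1) + r k <= sum_v (deg v) ^ 2] for any subfamily of [k]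
   edges.  When all degrees are at most 2 this gives [k2 <= r + 1].  When they
   are at most 3, we use moreover that the live vertices of a single part,
   together with the [t4] vertices already chosen, form a cover, so that each
   part has at least [r - 1 - t4] live vertices; this bounds the sum of squares
   and yields [k3 ^ 2 <= 3 r (k3 - r + t4)] up to lower-order terms.
   Minimizing [4 t4 + k3] under these constraints gives the constant. *)
Require Import Defs.
From HB Require Import structures.
From mathcomp Require Import all_boot all_order all_algebra.
From mathcomp Require Import reals.
From mathcomp Require Import zify ring lra.
Import Order.TTheory GRing.Theory Num.Theory.
Local Open Scope ring_scope.

Section Hypergraph.

Set Implicit Arguments.
Unset Strict Implicit.

Local Open Scope nat_scope.

Variable V : finType.
Implicit Types (G H : {set {set V}}) (C : {set V}) (v : V).

(** * Residual families and greedy selection *)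

Definition degree G v := #|[set e in G | v \in e]|.

Definition residual G C := [set e in G | e :&: C == set0].

Lemma residual_sub G C : residual G C \subset G.
Proof. by apply/subsetP => e; rewrite inE => /andP[]. Qed.

Lemma residualU G A B : residual G (A :|: B) = residual (residual G A) B.
Proof.
by apply/setP => e; rewrite !inE setIUr setU_eq0 andbA.
Qed.

Lemma residual0 G : residual G set0 = G.
Proof. by apply/setP => e; rewrite inE setI0 eqxx andbT. Qed.

Lemma card_residual1 G v : degree G v + #|residual G [set v]| = #|G|.
Proof.
rewrite -(cardsID [set e : {set V} | v \in e] G); congr (_ + _).
  by apply: eq_card => e; rewrite !inE.
apply: eq_card => e; rewrite !inE andbC; congr andb.
by rewrite setI_eq0 disjoint_sym disjoints1.
Qed.

(** Induction on the number of edges: a vertex of degree above [D] removes at least [D.+1] edges,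
    which pays for adding it to [C]. *)
Lemma greedy_residual D G :
  exists C, (forall v, degree (residual G C) v <= D) /\
            D.+1 * #|C| + #|residual G C| <= #|G|.
Proof.
have [n] := ubnP #|G|; elim: n => // n IHn in G *; rewrite ltnS => leGn.
have [allD|] := boolP [forall v, degree G v <= D].
  exists set0; rewrite residual0 cards0 muln0; split=> // v.
  exact: (forallP allD).
rewrite negb_forall => /existsP[v]; rewrite -ltnNge => ltDv.
have cardG := card_residual1 G v.
have [|C [degC cardC]] := IHn (residual G [set v]); first by lia.
exists (v |: C); rewrite residualU; split=> //.
have : #|v |: C| <= #|C|.+1 by rewrite cardsU1; case: (_ \notin _).
by rewrite -(leq_pmul2l (ltn0Sn D)) mulnS; lia.
Qed.

Lemma cover_number_le H C : is_cover H C -> cover_number H <= #|C|.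
Proof.
move=> covC; rewrite /cover_number.
elim: (index_enum _) (mem_index_enum C) => // A s IHs.
rewrite inE big_cons => /predU1P[<-|/IHs leC]; first by rewrite covC geq_minl.
by case: ifP => // _; rewrite geq_min leC orbT.
Qed.

Lemma intersecting_sub G H :
  G \subset H -> intersecting H -> intersecting G.
Proof. by move=> /subsetP sGH iH e f /sGH eH /sGH; apply: iH. Qed.

Lemma r_partite_sub r G H : G \subset H -> r_partite r H -> r_partite r G.
Proof. by move=> /subsetP sGH [p pP]; exists p => e /sGH; apply: pP. Qed.

Lemma card_edge r H e : r_partite r H -> e \in H -> #|e| = r.
Proof.
move=> [p pP] eH.
rewrite -sum1_card (partition_big p xpredT) //= -[RHS]card_ord -sum1_card.
apply: eq_bigr => i _; rewrite sum1_card -(pP e eH i).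
by apply: eq_card => v; rewrite !inE.
Qed.

(** * Double counting of degrees *)

Lemma degreeE G v : degree G v = \sum_(e in G) (v \in e).
Proof.
rewrite /degree -sum1_card big_mkcond [RHS]big_mkcond.
by apply: eq_bigr => e _; rewrite inE; case: (e \in G); case: (v \in e).
Qed.

Lemma sum_degree r G : r_partite r G -> \sum_v degree G v = r * #|G|.
Proof.
move=> pG; under eq_bigr do rewrite degreeE.
rewrite exchange_big mulnC -sum_nat_const; apply: eq_bigr => e eG.
by rewrite -(card_edge pG eG) -sum1_card [RHS]big_mkcond.
Qed.

Lemma sum_degree_sq G :
  \sum_v degree G v ^ 2 = \sum_(e in G) \sum_(f in G) #|e :&: f|.
Proof.
transitivity (\sum_v \sum_(e in G) \sum_(f in G) (v \in e :&: f)).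
  apply: eq_bigr => v _; rewrite degreeE -mulnn big_distrl.
  apply: eq_bigr => e _; rewrite big_distrr; apply: eq_bigr => f _.
  by rewrite inE -mulnb.
rewrite exchange_big; apply: eq_bigr => e _.
rewrite exchange_big; apply: eq_bigr => f _.
by rewrite -sum1_card [RHS]big_mkcond.
Qed.

(** Among ordered pairs of edges, a diagonal pair contributes [r] to the sum of [#|e :&: f|], any
    other at least 1. *)
Lemma sum_degree_sq_ge r G : r_partite r G -> intersecting G ->
  #|G| * #|G|.-1 + r * #|G| <= \sum_v degree G v ^ 2.
Proof.
move=> pG iG; rewrite sum_degree_sq [r * _]mulnC -mulnDr -sum_nat_const.
apply: leq_sum => e eG; rewrite (bigD1 e) //= setIid (card_edge pG eG) addnC.
rewrite leq_add2l (cardsD1 e G) eG /= -sum1_card.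
rewrite (eq_bigl [pred f in G | f != e]); last first.
  by move=> f; rewrite !inE andbC.
by apply: leq_sum => f /andP[fG _]; rewrite card_gt0 iG.
Qed.

Lemma card_degree_le1 G : intersecting G -> (forall v, degree G v <= 1) ->
  #|G| <= 1.
Proof.
move=> iG deg1; apply/card_le1_eqP => e f eG fG.
have /set0Pn[v] := iG e f eG fG; rewrite inE => /andP[ve vf].
by apply: (card_le1_eqP (deg1 v)); rewrite inE ?eG ?fG.
Qed.

Lemma card_degree_le2 r G : r_partite r G -> intersecting G ->
  (forall v, degree G v <= 2) -> #|G| <= r.+1.
Proof.
move=> pG iG deg2; have := sum_degree_sq_ge pG iG.
(* With [d ^ 2 <= 2 d] the lower bound becomes [k (k - 1) + r k <= 2 r k]. *)
have : \sum_v degree G v ^ 2 <= \sum_v 2 * degree G v.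
  by apply: leq_sum => v _; rewrite -mulnn leq_mul2r deg2 orbT.
rewrite -big_distrr /= (sum_degree pG) => /[swap] /leq_trans /[apply].
by case: #|G| => // k /=; nia.
Qed.

(* The live vertices of one part, together with [C], cover [H]. *)
Lemma card_part_ge r H C (p : V -> 'I_r) (i : 'I_r) :
  (forall e, e \in H -> #|[set v in e | p v == i]| = 1) ->
  cover_number H <=
    #|[set v | (p v == i) && (0 < degree (residual H C) v)]| + #|C|.
Proof.
move=> pP; set P := [set v | _].
apply: leq_trans (leq_card_setU P C).1; apply: cover_number_le.
apply/forallP => e; apply/implyP => eH; rewrite setIUr setU_eq0 negb_and.
have [eC|] := boolP (e :&: C == set0); last by rewrite orbT.
rewrite orbF; have /eqP/cards1P[v Ev] := pP e eH.
have : v \in [set v in e | p v == i] by rewrite Ev set11.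
rewrite inE => /andP[ve pv]; apply/set0Pn; exists v.
rewrite !inE ve pv /= card_gt0; apply/set0Pn; exists e.
by rewrite !inE eH eC ve.
Qed.

Lemma card_degree_le3 r H C : r_partite r H -> intersecting H ->
  (forall v, degree (residual H C) v <= 3) ->
  #|residual H C| * #|residual H C|.-1 + 3 * (r * cover_number H) <=
    3 * (r * #|residual H C|) + 3 * (r * #|C|).
Proof.
move=> pH iH deg3; set k := #|residual H C|.
have sGH := residual_sub H C.
have pG := r_partite_sub sGH pH.
have := sum_degree_sq_ge pG (intersecting_sub sGH iH); rewrite -/k => lek.
(* [d ^ 2 <= 4 d - 3] for [1 <= d <= 3]. *)
have degsq : \sum_v (degree (residual H C) v ^ 2
      + 3 * (0 < degree (residual H C) v)) <=
    \sum_v 4 * degree (residual H C) v.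
  apply: leq_sum => v _; have := deg3 v.
  by case: (degree _ v) => [|[|[|[|]]]].
rewrite big_split /= -!big_distrr /= (sum_degree pG) -/k in degsq.
(* What remains is a lower bound on the number of live vertices, counted part by part. *)
suff : r * cover_number H <=
    \sum_v (0 < degree (residual H C) v) + r * #|C| by lia.
have [p pP] := pH; rewrite (partition_big p xpredT) //=.
have sum_r c : r * c = \sum_(i < r) c by rewrite sum_nat_const card_ord.
rewrite !sum_r -big_split /=.
apply: leq_sum => i _; have := @card_part_ge _ _ C p i (fun e eH => pP e eH i).
move/leq_trans; apply; rewrite leq_add2r -sum1_card.
rewrite big_mkcond [X in _ <= X]big_mkcond; apply: leq_sum => v _.
by rewrite inE; case: (_ == _); case: (0 < _).
Qed.

(** Once degrees are at most 1, at most one edge is left, so the last phases cost about half of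
    [#|G2|]; doubling avoids fractions and [+ 2] absorbs the leftover edge. *)
Lemma greedy_cover H : intersecting H ->
  exists C4 C3 : {set V}, let G3 := residual H C4 in let G2 := residual G3 C3 in
  [/\ forall v, degree G3 v <= 3, forall v, degree G2 v <= 2,
      4 * #|C4| + #|G3| <= #|H|, 3 * #|C3| + #|G2| <= #|G3| &
      2 * cover_number H <= 2 * #|C4| + 2 * #|C3| + #|G2| + 2].
Proof.
move=> iH; have [C4 [deg3 card3]] := greedy_residual 3 H.
have [C3 [deg2 card2]] := greedy_residual 2 (residual H C4).
have [C2 [deg1 card1]] := greedy_residual 1 (residual (residual H C4) C3).
exists C4, C3; split=> //.
set G1 := residual _ C2 in deg1 card1.
have sG1 : G1 \subset H by rewrite /G1 -!residualU residual_sub.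
have leG1 := card_degree_le1 (intersecting_sub sG1 iH) deg1.
have [C0 [deg0 card0]] := greedy_residual 0 G1.
have : is_cover H (C4 :|: C3 :|: C2 :|: C0).
  apply/forallP => e; apply/implyP => eH; apply/negP => eC.
  have : e \in residual G1 C0 by rewrite -!residualU !setUA inE eH eC.
  move=> eG.
  (* An edge meets itself, so an uncovered edge would have a vertex of positive residual degree. *)
  have /set0Pn[v ve] : e != set0 by have := iH e e eH eH; rewrite setIid.
  have := deg0 v; rewrite leqn0 cards_eq0 => /eqP/setP/(_ e).
  by rewrite !inE in eG *; rewrite eG ve.
move/cover_number_le.
have := (leq_card_setU (C4 :|: C3 :|: C2) C0).1.
have := (leq_card_setU (C4 :|: C3) C2).1.
have := (leq_card_setU C4 C3).1.
lia.
Qed.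

End Hypergraph.

(* [q] is [1 / sqrt 18]; the two lower bounds for [m] given by the hypotheses
   cross at [k3 = (1 + 3 q) r]. *)
Lemma edge_bound (R : realFieldType) (q r m t4 t3 k3 k2 : R) :
  0 < q -> q ^+ 2 = 18^-1 -> 1 <= r -> 0 <= t4 ->
  4 * t4 + k3 <= m -> 3 * t3 + k2 <= k3 -> k2 <= r + 1 ->
  2 * (r - 1) <= 2 * t4 + 2 * t3 + k2 + 2 ->
  k3 * (k3 - 1) + 3 * (r * (r - 1)) <= 3 * (r * k3) + 3 * (r * t4) ->
  (3 - q) * r - 9 <= m.
Proof.
move=> q0 q2 r1 t40 m4 m3 k2r cov quad.
have [k3r|k3r] := leP (3 * r) k3; first by nra.
(* Eliminating [k2], [t3], [t4] from the linear constraints gives [m >= (10 r - k3 - 26) / 3],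
   decreasing in [k3]. *)
have [k3x|k3x] := leP k3 ((1 + 3 * q) * r); first by nra.
have q1 : 1 / 5 < q by nra.
have [d [d0 k3E]] : exists d, 0 < d /\ k3 = (1 + 3 * q) * r + d.
  by exists (k3 - (1 + 3 * q) * r); split; lra.
(* As [k3 < 3 r], the quadratic constraint gives [3 r m >= 4 k3 ^ 2 - 9 r k3 + 12 r ^ 2 - 24 r],
   increasing in [d] because [24 q > 1]. *)
have rm : 3 * (r * m) >= r ^+ 2 * (9 - 3 * q) - 24 * r.
  have H1 : 0 <= d * r by apply: mulr_ge0; lra.
  have H2 : 0 <= (d * r) * (24 * q - 1) by apply: mulr_ge0 => //; lra.
  have H3 : r * (4 * t4 + k3) <= r * m by rewrite ler_pM2l //; lra.
  have H4 : 4 * k3 ^+ 2 - 9 * (r * k3) + 12 * r ^+ 2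
     = r ^+ 2 * (9 - 3 * q) + d * r * (24 * q - 1) + 4 * d ^+ 2
       + 36 * r ^+ 2 * (q ^+ 2 - 18^-1).
    by rewrite k3E; field.
  rewrite q2 subrr mulr0 addr0 in H4.
  have := sqr_ge0 d; lra.
by rewrite -(ler_pM2l (_ : 0 < 3 * r)); [nra | lra].
Qed.

(* f(r) >= (3 - 1/sqrt 18) r (1 - o(1)): for every eps > 0 there is r0 such
   that for all r >= r0, every r-partite intersecting hypergraph with
   tau >= r - 1 has at least (3 - 1/sqrt 18) * r * (1 - eps) edges. *)
Theorem theorem1 (R : realType) (eps : R) (heps : 0 < eps) :
  exists r0 : nat, forall r : nat, (r0 <= r)%N ->
    forall (V : finType) (H : {set {set V}}),
      r_partite r H -> intersecting H -> (r - 1 <= cover_number H)%N ->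
      (3 - (Num.sqrt (18 : R))^-1) * r%:R * (1 - eps) <= (#|H|)%:R.
Proof.
(* Once [r eps > 9], the additive loss 9 is absorbed, since [3 - q > 1]. *)
exists (Num.truncn (9 / eps)).+1 => r ltr V H pH iH tauH.
have r9 : 9 / eps < r%:R.
  by apply: lt_le_trans (truncnS_gt _) _; rewrite ler_nat.
have r1 : (1 <= r)%N by apply: leq_trans ltr.
set q := (Num.sqrt _)^-1.
have q0 : 0 < q by rewrite invr_gt0 sqrtr_gt0.
have q2 : q ^+ 2 = 18^-1 by rewrite exprVn sqr_sqrtr.
have [C4 [C3 [deg3 deg2 card4 card3 cov]]] := greedy_cover iH.
set G3 := residual H C4 in deg3 card4 card3 *.
have sG2 : residual G3 C3 \subset H by rewrite -residualU residual_sub.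
have card2 := card_degree_le2 (r_partite_sub sG2 pH)
  (intersecting_sub sG2 iH) deg2.
have quad := card_degree_le3 pH iH deg3; rewrite -/G3 in quad.
have /= := @edge_bound R q r%:R #|H|%:R #|C4|%:R #|C3|%:R #|G3|%:R
  #|residual G3 C3|%:R q0 q2.
have -> : r%:R - 1 = (r - 1)%:R :> R by rewrite natrB.
have leq_natR (a b : nat) : (a <= b)%N -> a%:R <= b%:R :> R by rewrite ler_nat.
move=> /(_ _ _ _ _ _ _ _)/wrap[].
- by rewrite ler1n.
- exact: ler0n.
- by have /leq_natR := card4; rewrite natrD natrM.
- by have /leq_natR := card3; rewrite natrD natrM.
- by have /leq_natR := card2; rewrite -addn1 natrD.
- have /leq_natR : (2 * (r - 1) <= 2 * #|C4| + 2 * #|C3| +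
     #|residual G3 C3| + 2)%N by apply: leq_trans cov; rewrite leq_mul2l.
  by rewrite natrM 3!natrD 2!natrM.
- have : (#|G3| * #|G3|.-1 + 3 * (r * (r - 1)) <=
    3 * (r * #|G3|) + 3 * (r * #|C4|))%N.
    by apply: leq_trans quad; rewrite leq_add2l !leq_mul2l tauH !orbT.
  move/leq_natR; rewrite 2!natrD 7!natrM; apply: le_trans.
  (* At 0 the predecessor is truncated, but the product vanishes. *)
  rewrite lerD2r; case: #|G3| => [|k]; first by rewrite !mul0r.
  by rewrite /= -[k.+1]addn1 natrD addrK.
have := r9; rewrite ltr_pdivrMr // => r9'.
have q1 : q < 1 by nra.
have re : 0 <= r%:R * eps by apply: mulr_ge0; [exact: ler0n | exact: ltW].
nra.
Qed.
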